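(* Let $n\geq 5$ and $x,y,z,a>0$, and suppose $z\leq\min\{a,y,x\}$. If none of the following holds: (i) $z<x<y<a$ and $x<1$; (ii) $z<a<y<x$ and $1<y$; (iii) $z\leq y<1<\min\{a,x\}$, then the Perron eigenvector of $Z_n(x,y,z,a)$ is efficient for $Z_n(x,y,z,a)$.
   Context: $Z_n(x,y,z,a)$ is the $n\times n$ matrix all of whose entries equal $1$ except: entry $(1,n-1)=y$, $(1,n)=x$, $(2,n-1)=a$, $(2,n)=z$, and $(n-1,1)=1/y$, $(n,1)=1/x$, $(n-1,2)=1/a$, $(n,2)=1/z$. It is a reciprocal matrix. The Perron eigenvector is the positive eigenvector associated with the largest eigenvalue, normalized to have first component $1$. A positive vector $w$ is efficient for a reciprocal matrix $A=[a_{ij}]$ if there is no other positive vector $w'$ with $|a_{ij}-w'_i/w'_j|\leq|a_{ij}-w_i/w_j|$ for all $i,j$ with strict inequality for at least one pair $(i,j)$. *)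

(* Defs.v *)
From mathcomp Require Import all_boot all_order all_algebra.
From mathcomp Require Import reals.

Set Implicit Arguments.
Unset Strict Implicit.
Unset Printing Implicit Defensive.

Import Order.TTheory GRing.Theory Num.Theory.

Local Open Scope ring_scope.

(* The entries are listed by their 1-based position (row, column), whereas
   'I_n is 0-based, hence the successors. The eight special positions are
   pairwise distinct only when 4 <= n. *)
Definition Zmx (R : realType) (n : nat) (x y z a : R) : 'M[R]_n :=
  \matrix_(i < n, j < n)
    let p := (i.+1, j.+1) in
    if p == (1, n.-1)%N then y
    else if p == (1, n)%N then x
    else if p == (2, n.-1)%N then a
    else if p == (2, n)%N then z
    else if p == (n.-1, 1)%N then y^-1
    else if p == (n, 1)%N then x^-1
    else if p == (n.-1, 2)%N then a^-1
    else if p == (n, 2)%N then z^-1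
    else 1.

Definition positive_vec (R : realType) (n : nat) (w : 'cV[R]_n) : Prop :=
  forall i, 0 < w i 0.

Definition largest_eigenvalue (R : realType) (n : nat) (A : 'M[R]_n)
    (lambda : R) : Prop :=
  eigenvalue A lambda /\ forall mu : R, eigenvalue A mu -> mu <= lambda.

(* [eigenvalue] is defined through row vectors; the eigenvalues are the same on
   both sides, but the Perron eigenvector is the right (column) one. *)
Definition perron_eigenvector (R : realType) (n : nat) (A : 'M[R]_n)
    (w : 'cV[R]_n) : Prop :=
  [/\ positive_vec w,
      exists2 lambda : R, largest_eigenvalue A lambda & A *m w = lambda *: w
    & forall i : 'I_n, i = 0%N :> nat -> w i 0 = 1].

Definition efficient (R : realType) (n : nat) (A : 'M[R]_n)
    (w : 'cV[R]_n) : Prop :=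
  positive_vec w /\
  ~ exists w' : 'cV[R]_n,
      [/\ w' <> w, positive_vec w',
          forall i j, `|A i j - w' i 0 / w' j 0| <= `|A i j - w i 0 / w j 0|
        & exists i j, `|A i j - w' i 0 / w' j 0| < `|A i j - w i 0 / w j 0|].

(* Main.v *)
(* Suppose w' dominates the eigenvector w, and let T be the set of indices where
   w'_i / w_i is maximal. Then every i outside T strictly dominates every j in T:
   w_i > a_ij w_j. So it suffices to show that no nonempty proper set of indices
   strictly dominates its complement.
   The middle rows of Z_n are identical, so the middle entries of w are equal, and
   they cannot be separated by such a set: only five classes of indices remain. An
   eigenvalue l with a positive eigenvector satisfies n <= l by AM-GM, whereas a row
   weakly dominating all the others, not always with equality, would give l < n; this
   excludes dominating sets of at most two classes. For dominated sets of at most two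
   classes, identities such as
     l (w_1 - y w_{n-1}) = (1-y)(n-4) c + (x-y) w_n + (1-y/a) w_2,
   c being the middle entry, turn the comparisons into constraints on the order of
   x, y, z, a and 1, which hold only in the cases (i), (ii) and (iii). *)
Require Import Defs.
From mathcomp Require Import all_boot all_order all_algebra.
From mathcomp Require Import reals.
From mathcomp Require Import ring lra zify.

Import Order.TTheory GRing.Theory Num.Theory.
Local Open Scope ring_scope.

(** * Lower bound for an eigenvalue with a positive eigenvector *)

Lemma addr_ge2_of_mul1 (F : realFieldType) (u v : F) :
  0 < u -> u * v = 1 -> 2%:R <= u + v.
Proof.
move=> u0 uv1; rewrite -(ler_pM2l u0) [u * (_ + v)]mulrDr uv1 -subr_ge0.
by rewrite [leRHS](_ : _ = (u - 1) ^+ 2) ?sqr_ge0 //; ring.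
Qed.

(** The rescaled matrix [b i j] is again reciprocal and all its row sums equal [l]. Summing
    [b i j + b j i >= 2] over all pairs gives [2 n^2 <= 2 n l]. *)
Lemma reciprocal_eigenvalue_ge (R : realType) (n : nat) (A : 'M[R]_n)
    (w : 'cV[R]_n) (l : R) :
  (0 < n)%N -> (forall i j, 0 < A i j) -> (forall i j, A i j * A j i = 1) ->
  positive_vec w -> A *m w = l *: w -> n%:R <= l.
Proof.
move=> n0 A0 A1 w0 Aw.
pose b i j := A i j * w j 0 / w i 0.
have bsum i : \sum_j b i j = l.
  rewrite -mulr_suml; move/matrixP/(_ i 0): Aw; rewrite !mxE => ->.
  by rewrite mulfK // gt_eqF.
have b2 i j : 2%:R <= b i j + b j i.
  apply: addr_ge2_of_mul1; first by rewrite !mulr_gt0 ?invr_gt0.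
  rewrite (_ : b i j * b j i = A i j * A j i) //.
  by rewrite /b; field; rewrite !gt_eqF.
have : \sum_(i < n) \sum_(j < n) 2%:R <= \sum_i \sum_j (b i j + b j i).
  by apply: ler_sum => i _; apply: ler_sum.
have -> : \sum_i \sum_j (b i j + b j i) = (l + l) *+ n.
  under eq_bigr do rewrite big_split /= bsum.
  rewrite big_split /= exchange_big /=.
  by under [X in _ + X]eq_bigr do rewrite bsum; rewrite !sumr_const card_ord mulrnDl.
rewrite !sumr_const !card_ord ler_pMn2r //.
by rewrite -mulr2n -mulrnA mulnC mulrnA lerMn2r.
Qed.

(** * Efficiency from the absence of strictly dominating sets *)

Lemma sum_support2 (V : nmodType) (I : finType) (f : I -> V) (p q : I) :
  p != q -> (forall i, i != p -> i != q -> f i = 0) -> \sum_i f i = f p + f q.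
Proof.
move=> pq f0; rewrite (bigD1 p) //= (bigD1 q) 1?eq_sym //= big1 ?addr0 //.
by move=> i /andP[ip iq]; apply: f0.
Qed.

Lemma efficient_of_no_dominating_set (R : realType) (n : nat) (A : 'M[R]_n)
    (w : 'cV[R]_n) :
  positive_vec w ->
  (forall s : pred 'I_n, (forall i j, s i -> ~~ s j -> A i j * w j 0 < w i 0) ->
     forall i j, s i = s j) ->
  efficient A w.
Proof.
move=> w0 noS; split=> // -[w' [_ w'0 le [i [j lt]]]].
pose u k := w' k 0 / w k 0.
have [m _ um] := @arg_maxP _ _ _ i xpredT u isT.
have s_const := noS (fun k => u k < u m).
have {}s_const : forall k, u k = u m.
  move=> k; apply: le_anti; rewrite [u k <= _](um k isT) /= leNgt; apply/negP => km.
  have := s_const _ k m; rewrite km ltxx => /(_ _) H; suff: true = false by [].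
  apply: H => {km}k1 k2 lt1; rewrite -leNgt => le2.
  have lt12 : u k1 < u k2 by apply: lt_le_trans le2.
  (* Passing to [w'] strictly lowers the ratio at [(k1, k2)]. If the ratio for [w] were already at
     most [A k1 k2], the error there would grow. *)
  rewrite ltNge; apply/negP => leA.
  have leA' : w k1 0 / w k2 0 <= A k1 k2 by rewrite ler_pdivrMr.
  have := le k1 k2; rewrite [X in _ <= X]ger0_norm ?subr_ge0 //.
  move/(le_trans (ler_norm _)); rewrite lerD2l lerN2 leNgt => /negP; apply.
  rewrite ltr_pdivrMr // mulrAC ltr_pdivlMr //.
  by move: lt12; rewrite /u ltr_pdivrMr // mulrAC ltr_pdivlMr // [w' k2 0 * _]mulrC.
(* Now [u] is constant, so [w'] is a multiple of [w] and no error can decrease strictly. *)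
suff e : w' i 0 / w' j 0 = w i 0 / w j 0 by move: lt; rewrite e ltxx.
have w'E k : w' k 0 = u m * w k 0 by rewrite -(s_const k) /u mulfVK // gt_eqF.
have um0 : u m != 0 by rewrite gt_eqF // /u divr_gt0.
by rewrite !w'E; field; rewrite um0 gt_eqF.
Qed.

(** * Positivity and reciprocity of [Zmx] *)

Lemma Zmx_gt0 (R : realType) (n : nat) (x y z a : R) (i j : 'I_n) :
  0 < x -> 0 < y -> 0 < z -> 0 < a -> 0 < Zmx n x y z a i j.
Proof. by move=> *; rewrite mxE /=; do !case: ifP => _; rewrite ?invr_gt0. Qed.

Lemma Zmx_reciprocal (R : realType) (n : nat) (x y z a : R) (i j : 'I_n) :
  (4 <= n)%N -> 0 < x -> 0 < y -> 0 < z -> 0 < a ->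
  Zmx n x y z a i j * Zmx n x y z a j i = 1.
Proof.
case: n i j => [|[|[|[|k]]]] // i j _ x0 y0 z0 a0; rewrite !mxE /= !xpair_eqE.
have k34 : (k.+3 == k.+4) = false by rewrite ltn_eqF.
have k43 : (k.+4 == k.+3) = false by rewrite gtn_eqF.
case: ifP => [/andP[/eqP-> /eqP->] | c1]; first by rewrite !eqxx /= divff ?gt_eqF.
case: ifP => [/andP[/eqP-> /eqP->] | c2].
  by rewrite !eqxx /= k43 divff ?gt_eqF.
case: ifP => [/andP[/eqP-> /eqP->] | c3].
  by rewrite !eqxx /= andbF divff ?gt_eqF.
case: ifP => [/andP[/eqP-> /eqP->] | c4].
  by rewrite !eqxx /= k43 ?andbF divff ?gt_eqF.
case: ifP => [/andP[/eqP-> /eqP->] | c5]; first by rewrite !eqxx /= mulVf ?gt_eqF.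
case: ifP => [/andP[/eqP-> /eqP->] | c6].
  by rewrite !eqxx /= k43 mulVf ?gt_eqF.
case: ifP => [/andP[/eqP-> /eqP->] | c7].
  by rewrite !eqxx /= mulVf ?gt_eqF.
case: ifP => [/andP[/eqP-> /eqP->] | c8].
  by rewrite !eqxx /= k43 mulVf ?gt_eqF.
(* The special positions are closed under transposition, so both entries are 1. *)
by rewrite !(andbC (j.+1 == _)) c1 c2 c3 c4 c5 c6 c7 c8 mulr1.
Qed.

(** * Comparisons between the five classes of positions *)

Lemma addr_gt0_or (F : realDomainType) (u v : F) : 0 < u + v -> (0 < u) || (0 < v).
Proof.
rewrite ltNge [0 < u]ltNge [0 < v]ltNge -negb_and; apply: contra => /andP[u0 v0].
by rewrite -[leRHS]addr0 lerD.
Qed.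

(** The weights 1, 1, [m], 1, 1 add up to [m + 4 <= l], so a weighted sum of terms at most [w]
    reaches [l * w] only if every term equals [w]. *)
Lemma dominant_row (F : realFieldType) (m l w u1 u2 u3 u4 u5 : F) :
  0 < m -> 0 < w -> m + 4%:R <= l -> l * w = u1 + u2 + m * u3 + u4 + u5 ->
  u1 <= w -> u2 <= w -> u3 <= w -> u4 <= w -> u5 <= w ->
  [/\ w <= u1, w <= u2, w <= u3, w <= u4 & w <= u5].
Proof.
move=> m0 w0 ln e h1 h2 h3 h4 h5.
have : (m + 4%:R) * w <= l * w by rewrite ler_pM2r.
have : m * u3 <= m * w by rewrite ler_pM2l.
by rewrite e -[w <= u3](ler_pM2l m0) => ? ?; split; lra.
Qed.

Ltac specialize_all :=
  repeat match goal with
  | H : is_true true -> _ |- _ => specialize (H isT)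
  | H : is_true false -> _ |- _ => clear H
  end.

(** Here [s] turns the weak dominance of one class into the reverse inequalities, one of which
    contradicts a strict comparison. *)
Ltac by_source s :=
  case: s; try assumption; try (apply: ltW; assumption); move=> ? ? ? ?;
  match goal with H : is_true (?u < ?v), K : is_true (?v <= ?u) |- _ =>
    by rewrite leNgt H in K end.

Ltac by_sources s1 s2 sc sp sq :=
  first [by_source s1 | by_source s2 | by_source sc | by_source sp | by_source sq].
(** Two dominating classes are not compared with each other by hypothesis; whichever is larger
    weakly dominates everything. *)
Ltac by_pair s1 s2 sc sp sq u v :=
  by case: (leP u v) => ?; by_sources s1 s2 sc sp sq.

(* [A], [B], [C], [P], [Q] are the entries of the eigenvector at positions 1, 2, any
   middle one, n-1, n, with [m] = n-4 middle positions. The booleans mark the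
   positions belonging to a set that strictly dominates its complement. *)
Lemma no_dominating_class (F : realFieldType) (x y z a m l A B C P Q : F)
    (b1 b2 bc bp bq : bool) :
  0 < x -> 0 < y -> 0 < z -> 0 < a -> 0 < m ->
  0 < A -> 0 < B -> 0 < C -> 0 < P -> 0 < Q ->
  z <= a -> z <= y -> z <= x ->
  ~ (z < x /\ x < y /\ y < a /\ x < 1) ->
  ~ (z < a /\ a < y /\ y < x /\ 1 < y) ->
  ~ (y < 1 /\ 1 < a /\ 1 < x) ->
  m + 4%:R <= l ->
  l * C = A + B + m * C + P + Q ->
  l * A = A + B + m * C + y * P + x * Q ->
  l * B = A + B + m * C + a * P + z * Q ->
  l * P = y^-1 * A + a^-1 * B + m * C + P + Q ->
  l * Q = x^-1 * A + z^-1 * B + m * C + P + Q ->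
  (b1 != b2 -> if b1 then B < A else A < B) ->
  (b1 != bc -> if b1 then C < A else A < C) ->
  (b2 != bc -> if b2 then C < B else B < C) ->
  (bp != bc -> if bp then C < P else P < C) ->
  (bq != bc -> if bq then C < Q else Q < C) ->
  (bp != bq -> if bp then Q < P else P < Q) ->
  (b1 != bp -> if b1 then y * P < A else A < y * P) ->
  (b1 != bq -> if b1 then x * Q < A else A < x * Q) ->
  (b2 != bp -> if b2 then a * P < B else B < a * P) ->
  (b2 != bq -> if b2 then z * Q < B else B < z * Q) ->
  [&& b1 == bc, b2 == bc, bp == bc & bq == bc].
Proof.
move=> x0 y0 z0 a0 m0 A0 B0 C0 P0 Q0 za zy zx ni nii niii ln eC eA eB eP eQ.
have l0 : 0 < l by rewrite (lt_le_trans _ ln) // addr_gt0.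
have mC0 : 0 < m * C by rewrite mulr_gt0.
(* A strict comparison makes a combination of positive entries positive, hence one of its
   coefficients is positive. *)
have lt_coef (u v t : F) : l * (v - u) = t -> u < v -> 0 < t.
  by move=> <- uv; rewrite mulr_gt0 // subr_gt0.
have lt_coef2 (u v s p t q : F) : l * (v - u) = s * p + t * q -> 0 < p -> 0 < q ->
    u < v -> 0 < s \/ 0 < t.
  move=> e p0 q0 /(lt_coef _ _ _ e)/addr_gt0_or.
  by rewrite !pmulr_lgt0 // => /orP.
have lt_coef3 (u v s p t q r o : F) : l * (v - u) = s * p + t * q + r * o ->
    0 < p -> 0 < q -> 0 < o -> u < v -> [\/ 0 < s, 0 < t | 0 < r].
  move=> e p0 q0 o0 /(lt_coef _ _ _ e)/addr_gt0_or.
  rewrite pmulr_lgt0 // orbC => /orP[? | /addr_gt0_or]; first by constructor 3.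
  by rewrite !pmulr_lgt0 // => /orP[]; [constructor 1 | constructor 2].
have inv_lt1 (u : F) : 0 < u -> (0 < 1 - u^-1) = (1 < u).
  by move=> u0; rewrite subr_gt0 invf_lt1.
have inv_gt1 (u : F) : 0 < u -> (0 < u^-1 - 1) = (u < 1).
  by move=> u0; rewrite subr_gt0 invf_gt1.
have inv_lt (u v : F) : 0 < u -> 0 < v -> (0 < u^-1 - v^-1) = (u < v).
  by move=> u0 v0; rewrite subr_gt0 ltf_pV2.
have div_lt1 (u v : F) : 0 < v -> (0 < 1 - u / v) = (u < v).
  by move=> v0; rewrite subr_gt0 ltr_pdivrMr // mul1r.
have div_gt1 (u v : F) : 0 < v -> (0 < u / v - 1) = (v < u).
  by move=> v0; rewrite subr_gt0 ltr_pdivlMr // mul1r.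
(* In these facts the first index names the smaller side. Alternatives contradicting the minimality
   of [z] are dropped. *)
have f12 : A < B -> y < a.
  have e : l * (B - A) = (a - y) * P + (z - x) * Q by rewrite mulrBr eA eB; ring.
  by case/(lt_coef2 _ _ _ _ _ _ e P0 Q0); rewrite subr_gt0 // ltNge zx.
have f1c : A < C -> y < 1 \/ x < 1.
  have e : l * (C - A) = (1 - y) * P + (1 - x) * Q by rewrite mulrBr eA eC; ring.
  by move/(lt_coef2 _ _ _ _ _ _ e P0 Q0); rewrite !subr_gt0.
have fc1 : C < A -> 1 < y \/ 1 < x.
  have e : l * (A - C) = (y - 1) * P + (x - 1) * Q by rewrite mulrBr eA eC; ring.
  by move/(lt_coef2 _ _ _ _ _ _ e P0 Q0); rewrite !subr_gt0.
have f2c : B < C -> z < 1.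
  have e : l * (C - B) = (1 - a) * P + (1 - z) * Q by rewrite mulrBr eB eC; ring.
  by case/(lt_coef2 _ _ _ _ _ _ e P0 Q0); rewrite subr_gt0 //; apply: le_lt_trans.
have fc2 : C < B -> 1 < a.
  have e : l * (B - C) = (a - 1) * P + (z - 1) * Q by rewrite mulrBr eB eC; ring.
  by case/(lt_coef2 _ _ _ _ _ _ e P0 Q0); rewrite subr_gt0 // => /lt_le_trans->.
have fpc : P < C -> 1 < y \/ 1 < a.
  have e : l * (C - P) = (1 - y^-1) * A + (1 - a^-1) * B.
    by rewrite mulrBr eP eC; ring.
  by move/(lt_coef2 _ _ _ _ _ _ e A0 B0); rewrite !inv_lt1.
have fcp : C < P -> y < 1 \/ a < 1.
  have e : l * (P - C) = (y^-1 - 1) * A + (a^-1 - 1) * B.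
    by rewrite mulrBr eP eC; ring.
  by move/(lt_coef2 _ _ _ _ _ _ e A0 B0); rewrite !inv_gt1.
have fqc : Q < C -> 1 < x.
  have e : l * (C - Q) = (1 - x^-1) * A + (1 - z^-1) * B.
    by rewrite mulrBr eQ eC; ring.
  case/(lt_coef2 _ _ _ _ _ _ e A0 B0); rewrite inv_lt1 // => z1.
  exact: lt_le_trans zx.
have fcq : C < Q -> z < 1.
  have e : l * (Q - C) = (x^-1 - 1) * A + (z^-1 - 1) * B.
    by rewrite mulrBr eQ eC; ring.
  case/(lt_coef2 _ _ _ _ _ _ e A0 B0); rewrite inv_gt1 //.
  exact: le_lt_trans.
have fpq : P < Q -> x < y \/ z < a.
  have e : l * (Q - P) = (x^-1 - y^-1) * A + (z^-1 - a^-1) * B.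
    by rewrite mulrBr eQ eP; ring.
  by move/(lt_coef2 _ _ _ _ _ _ e A0 B0); rewrite !inv_lt.
have fqp : Q < P -> y < x.
  have e : l * (P - Q) = (y^-1 - x^-1) * A + (a^-1 - z^-1) * B.
    by rewrite mulrBr eQ eP; ring.
  by case/(lt_coef2 _ _ _ _ _ _ e A0 B0); rewrite inv_lt // ltNge za.
have f1p : A < y * P -> [\/ 1 < y, x < y | a < y].
  have e : l * (y * P - A) = (y - 1) * (m * C) + (y - x) * Q + (y / a - 1) * B.
    by rewrite mulrBr mulrCA eA eP; field; rewrite !gt_eqF.
  by move/(lt_coef3 _ _ _ _ _ _ _ _ e mC0 Q0 B0); rewrite div_gt1 // !subr_gt0.
have fp1 : y * P < A -> [\/ y < 1, y < x | y < a].
  have e : l * (A - y * P) = (1 - y) * (m * C) + (x - y) * Q + (1 - y / a) * B.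
    by rewrite mulrBr mulrCA eA eP; field; rewrite !gt_eqF.
  by move/(lt_coef3 _ _ _ _ _ _ _ _ e mC0 Q0 B0); rewrite div_lt1 // !subr_gt0.
have f1q : A < x * Q -> [\/ 1 < x, y < x | z < x].
  have e : l * (x * Q - A) = (x - 1) * (m * C) + (x - y) * P + (x / z - 1) * B.
    by rewrite mulrBr mulrCA eA eQ; field; rewrite !gt_eqF.
  by move/(lt_coef3 _ _ _ _ _ _ _ _ e mC0 P0 B0); rewrite div_gt1 // !subr_gt0.
have fq1 : x * Q < A -> x < 1 \/ x < y.
  have e : l * (A - x * Q) = (1 - x) * (m * C) + (y - x) * P + (1 - x / z) * B.
    by rewrite mulrBr mulrCA eA eQ; field; rewrite !gt_eqF.
  move/(lt_coef3 _ _ _ _ _ _ _ _ e mC0 P0 B0); rewrite div_lt1 // !subr_gt0.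
  by rewrite [x < z]ltNge zx; case=> //; [left | right].
have fp2 : a * P < B -> a < 1 \/ a < y.
  have e : l * (B - a * P) = (1 - a) * (m * C) + (z - a) * Q + (1 - a / y) * A.
    by rewrite mulrBr mulrCA eB eP; field; rewrite !gt_eqF.
  move/(lt_coef3 _ _ _ _ _ _ _ _ e mC0 Q0 A0); rewrite div_lt1 // !subr_gt0.
  by rewrite [a < z]ltNge za; case=> //; [left | right].
have f2q : B < z * Q -> 1 < z.
  have e : l * (z * Q - B) = (z - 1) * (m * C) + (z - a) * P + (z / x - 1) * A.
    by rewrite mulrBr mulrCA eB eQ; field; rewrite !gt_eqF.
  move/(lt_coef3 _ _ _ _ _ _ _ _ e mC0 P0 A0); rewrite div_gt1 // !subr_gt0.
  by rewrite [a < z]ltNge za [x < z]ltNge zx; case.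
have s1 : B <= A -> C <= A -> y * P <= A -> x * Q <= A ->
    [/\ A <= B, A <= C, A <= y * P & A <= x * Q].
  by move=> *; have [] := dominant_row _ _ _ _ _ _ _ _ _ m0 A0 ln eA.
have s2 : A <= B -> C <= B -> a * P <= B -> z * Q <= B ->
    [/\ B <= A, B <= C, B <= a * P & B <= z * Q].
  by move=> *; have [] := dominant_row _ _ _ _ _ _ _ _ _ m0 B0 ln eB.
have sc : A <= C -> B <= C -> P <= C -> Q <= C ->
    [/\ C <= A, C <= B, C <= P & C <= Q].
  by move=> *; have [] := dominant_row _ _ _ _ _ _ _ _ _ m0 C0 ln eC.
(* The row of [P] has coefficients [y^-1] and [a^-1], so the comparisons are rescaled before
   [dominant_row] applies. *)
have sp : A <= y * P -> B <= a * P -> C <= P -> Q <= P ->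
    [/\ y * P <= A, a * P <= B, P <= C & P <= Q].
  rewrite -[A <= _]ler_pdivrMl // -[B <= _]ler_pdivrMl // -[_ <= A]ler_pdivlMl //.
  rewrite -[_ <= B]ler_pdivlMl // => *.
  by have [] := dominant_row _ _ _ _ _ _ _ _ _ m0 P0 ln eP.
have sq : A <= x * Q -> B <= z * Q -> C <= Q -> P <= Q ->
    [/\ x * Q <= A, z * Q <= B, Q <= C & Q <= P].
  rewrite -[A <= _]ler_pdivrMl // -[B <= _]ler_pdivrMl // -[_ <= A]ler_pdivlMl //.
  rewrite -[_ <= B]ler_pdivlMl // => *.
  by have [] := dominant_row _ _ _ _ _ _ _ _ _ m0 Q0 ln eQ.
clear ln eC eA eB eP eQ l0 mC0 lt_coef lt_coef2 lt_coef3.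
clear inv_lt1 inv_gt1 inv_lt div_lt1 div_gt1 m0 m l.
(* The two trivial sets are closed at once; in the 30 others only comparisons across the set
   remain. *)
case: bc b1 b2 bp bq => [] [] [] [] [] //= h12 h1c h2c hpc hqc hpq h1p h1q h2p h2q;
  specialize_all.
all: exfalso.
(* If at most two classes dominate the others, one of them weakly dominates every
   class, so that its row forces [l < m + 4]. *)
all: try by_sources s1 s2 sc sp sq.
all: try first [by_pair s1 s2 sc sp sq A B
          | by_pair s1 s2 sc sp sq A C
          | by_pair s1 s2 sc sp sq B C
          | by_pair s1 s2 sc sp sq P C
          | by_pair s1 s2 sc sp sq Q C
          | by_pair s1 s2 sc sp sq Q P
          | by_pair s1 s2 sc sp sq A (y * P)
          | by_pair s1 s2 sc sp sq B (a * P)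
          | by_pair s1 s2 sc sp sq A (x * Q)
          | by_pair s1 s2 sc sp sq B (z * Q)].
(* At most two classes are dominated: the sign of each strict comparison constrains
   the order of [x], [y], [z], [a] and [1]. *)
all: clear s1 s2 sc sp sq.
(* Each strict comparison of entries is replaced by the order constraint it implies. *)
all: repeat match goal with f : is_true ?p -> _, h : is_true ?p |- _ =>
    move: (f h) => {}f; clear h end.
all: repeat match goal with f : is_true (_ < _) -> _ |- _ => clear f end.
all: clear A0 B0 C0 P0 Q0.
all: try lra.
all: repeat match goal with
     | H : _ \/ _ |- _ => case: H => H
     | H : or3 _ _ _ |- _ => case: H => H
     end.
all: first [lra | by case: ni; do ?split; lra | by case: nii; do ?split; lra
           | by case: niii; do ?split; lra].
Qed.

(** * Reduction of the matrix to five classes *)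

Theorem theorem9 (R : realType) (n : nat) (x y z a : R)
    (hn : (5 <= n)%N) (hx : 0 < x) (hy : 0 < y) (hz : 0 < z) (ha : 0 < a)
    (hmin : z <= Num.min a (Num.min y x))
    (not_i : ~ (z < x /\ x < y /\ y < a /\ x < 1))
    (not_ii : ~ (z < a /\ a < y /\ y < x /\ 1 < y))
    (not_iii : ~ (z <= y /\ y < 1 /\ 1 < Num.min a x))
    (w : 'cV[R]_n) (hw : perron_eigenvector (Zmx n x y z a) w) :
  efficient (Zmx n x y z a) w.
Proof.
move: hmin; rewrite !le_min => /and3P[za zy zx].
(* With [n = k + 5] there are [k + 1] middle positions, represented by [oc]. *)
case: n hn w hw => [|[|[|[|[|k]]]]] // _ w [w0 [l _ Aw] _].
set Z := Zmx _ x y z a in Aw *.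
have ln : k.+4.+1%:R <= l.
  apply: reciprocal_eigenvalue_ge w0 Aw => // i j; first exact: Zmx_gt0.
  exact: Zmx_reciprocal.
have l0 : 0 < l by apply: lt_le_trans ln; rewrite ltr0n.
pose o1 := @Ordinal k.+4.+1 0 isT; pose o2 := @Ordinal k.+4.+1 1 isT.
pose oc := @Ordinal k.+4.+1 2 isT.
pose op := @Ordinal k.+4.+1 k.+3 (leqnSn _); pose oq := @Ordinal k.+4.+1 k.+4 (leqnn _).
have k34 : (k == k.+1) = false by rewrite ltn_eqF.
have k43 : (k.+1 == k) = false by rewrite gtn_eqF.
have row i : l * w i 0 = \sum_j Z i j * w j 0.
  by move/matrixP/(_ i 0): Aw; rewrite !mxE => ->.
(* A row that is 1 outside [p] and [q] gives the total sum plus two corrections. *)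
have row2 i p q : p != q -> (forall j, j != p -> j != q -> Z i j = 1) ->
    l * w i 0 = \sum_j w j 0 + (Z i p - 1) * w p 0 + (Z i q - 1) * w q 0.
  move=> pq Z1; rewrite row -addrA.
  rewrite -(@sum_support2 _ _ (fun j => (Z i j - 1) * w j 0)) //; last first.
    by move=> j jp jq; rewrite Z1 // subrr mul0r.
  by rewrite -big_split /=; apply: eq_bigr => j _; ring.
have mid (i : 'I_k.+4.+1) : (1 < i < k.+3)%N -> forall j, Z i j = 1.
  move=> /andP[i1 i3] j; rewrite mxE /= !xpair_eqE !eqSS.
  by rewrite !(gtn_eqF i1) (gtn_eqF (ltnW i1)) (ltn_eqF i3) (ltn_eqF (leqW i3)) /=.
have rowm (i : 'I_k.+4.+1) : (1 < i < k.+3)%N -> l * w i 0 = \sum_j w j 0.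
  by move=> /mid Z1; rewrite row; apply: eq_bigr => j _; rewrite Z1 mul1r.
have Z1p : Z o1 op = y by rewrite mxE /= !xpair_eqE !eqSS ?eqxx ?k43 ?k34.
have Z1q : Z o1 oq = x by rewrite mxE /= !xpair_eqE !eqSS ?eqxx ?k43 ?k34.
have Z2p : Z o2 op = a by rewrite mxE /= !xpair_eqE !eqSS ?eqxx ?k43 ?k34.
have Z2q : Z o2 oq = z by rewrite mxE /= !xpair_eqE !eqSS ?eqxx ?k43 ?k34.
have Zp1 : Z op o1 = y^-1 by rewrite mxE /= !xpair_eqE !eqSS ?eqxx ?k43 ?k34.
have Zp2 : Z op o2 = a^-1 by rewrite mxE /= !xpair_eqE !eqSS ?eqxx ?k43 ?k34.
have Zq1 : Z oq o1 = x^-1 by rewrite mxE /= !xpair_eqE !eqSS ?eqxx ?k43 ?k34.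
have Zq2 : Z oq o2 = z^-1 by rewrite mxE /= !xpair_eqE !eqSS ?eqxx ?k43 ?k34.
have one1 j : j != op -> j != oq -> Z o1 j = 1.
  by rewrite -!val_eqE mxE /= !xpair_eqE !eqSS => /negbTE-> /negbTE->.
have one2 j : j != op -> j != oq -> Z o2 j = 1.
  by rewrite -!val_eqE mxE /= !xpair_eqE !eqSS => /negbTE-> /negbTE->.
have onep j : j != o1 -> j != o2 -> Z op j = 1.
  rewrite -!val_eqE mxE /= !xpair_eqE !eqSS => /negbTE-> /negbTE->.
  by rewrite !andbF.
have oneq j : j != o1 -> j != o2 -> Z oq j = 1.
  rewrite -!val_eqE mxE /= !xpair_eqE !eqSS => /negbTE-> /negbTE->.
  by rewrite !andbF.
have o12 : o1 != o2 by [].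
have oqp : oq != op by rewrite -val_eqE /= !eqSS k43.
have opq : op != oq by rewrite -val_eqE /= !eqSS k34.
have row1 := row2 o1 op oq opq one1; have rowB := row2 o2 op oq opq one2.
have rowp := row2 op o1 o2 o12 onep; have rowq := row2 oq o1 o2 o12 oneq.
rewrite Z1p Z1q in row1; rewrite Z2p Z2q in rowB.
rewrite Zp1 Zp2 in rowp; rewrite Zq1 Zq2 in rowq.
have is_mid (i : 'I_k.+4.+1) :
    i != o1 -> i != o2 -> i != op -> i != oq -> (1 < i < k.+3)%N.
  case: i => i /= ik; rewrite -!val_eqE /=; clear -ik; lia.
have midE (i : 'I_k.+4.+1) : (1 < i < k.+3)%N -> w i 0 = w oc 0.
  by move=> im; apply: (mulfI (lt0r_neq0 l0)); rewrite rowm // -(rowm oc).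
have sumE : \sum_j w j 0 = w o1 0 + w o2 0 + k.+1%:R * w oc 0 + w op 0 + w oq 0.
  (* After subtracting the middle value from every entry, only the four outer positions
     contribute. *)
  rewrite (eq_bigr (fun j => w oc 0 + (w j 0 - w oc 0))) => [|j _]; last by ring.
  have nE : w oc 0 *+ k.+4.+1 = k.+1%:R * w oc 0 + 4%:R * w oc 0.
    by rewrite -mulrDl -natrD addn4 mulr_natl.
  rewrite big_split /= sumr_const card_ord nE.
  rewrite (bigD1 o1) //= (bigD1 o2) //= (bigD1 op) //= (bigD1 oq) //= big1.
    by ring.
  move=> j /andP[/andP[/andP[j1 j2] jp] jq].
  by rewrite midE ?subrr ?is_mid.
rewrite sumE in row1 rowB rowp rowq.
have rowc := rowm oc isT; rewrite sumE in rowc.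
apply: efficient_of_no_dominating_set => // s dom.
have cmp i j : s i != s j ->
    if s i then Z i j * w j 0 < w i 0 else Z j i * w i 0 < w j 0.
  by case: ifP => si; case sj: (s j) => // _; apply: dom; rewrite ?si ?sj.
have cmp1 i j : Z i j = 1 -> Z j i = 1 -> s i != s j ->
    if s i then w j 0 < w i 0 else w i 0 < w j 0.
  by move=> e1 e2 /cmp; rewrite e1 e2 !mul1r.
(* Separating two middle positions would make their common entry strictly less than itself. *)
have s_mid (i : 'I_k.+4.+1) : (1 < i < k.+3)%N -> s i = s oc.
  move=> im; apply/eqP/negPn/negP => /(cmp1 _ _ (mid _ im oc) (mid oc isT i)).
  by rewrite midE // ltxx if_same.
have cmpV i j c : 0 < c -> Z i j = c -> Z j i = c^-1 -> s i != s j ->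
    if s i then c * w j 0 < w i 0 else w i 0 < c * w j 0.
  by move=> c0 e1 e2 /cmp; rewrite e1 e2 ltr_pdivrMl.
have : [&& s o1 == s oc, s o2 == s oc, s op == s oc & s oq == s oc].
  apply: (@no_dominating_class _ x y z a k.+1%:R l (w o1 0) (w o2 0) (w oc 0)
            (w op 0) (w oq 0)) => //; try exact: w0.
  - by move=> [y1 [a1 x1]]; apply: not_iii; rewrite lt_min a1 x1 y1.
  - by rewrite -natrD addn4.
  - by rewrite row1; ring.
  - by rewrite rowB; ring.
  - by rewrite rowp; ring.
  - by rewrite rowq; ring.
  - by apply: cmp1; [exact: one1 | exact: one2].
  - by apply: cmp1; [exact: one1 | exact: mid].
  - by apply: cmp1; [exact: one2 | exact: mid].
  - by apply: cmp1; [exact: onep | exact: mid].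
  - by apply: cmp1; [exact: oneq | exact: mid].
  - by apply: cmp1; [exact: onep | exact: oneq].
  - exact: cmpV.
  - exact: cmpV.
  - exact: cmpV.
  - exact: cmpV.
case/and4P=> /eqP s1 /eqP s2 /eqP sp /eqP sq.
suff s_const i : s i = s oc by move=> i j; rewrite !s_const.
have [->|i1] := eqVneq i o1; first exact: s1.
have [->|i2] := eqVneq i o2; first exact: s2.
have [->|ip] := eqVneq i op; first exact: sp.
have [->|iq] := eqVneq i oq; first exact: sq.
by apply: s_mid; apply: is_mid.
Qed.
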